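(* Let $n\ge 3$, let $\mathbf{m}=(m_1,\dots,m_n)\in\mathbb{R}^n_{>0}$ be non-dominating, and let $G$ be the complete graph on vertex set $V=[n]$ weighted by $\mathbf{m}$. Suppose $G$ admits at most $n-2$ balanced partitions, i.e. there exist at most $n-2$ distinct (unordered) partitions $\{S,S^c\}$ of $V$ with $\sum_{j\in S}m_j=\sum_{j\notin S}m_j$. Then the MAXCUT SDP of $G$ admits an optimal solution $\mathbf{X}_G$ that lies outside the convex hull of the rank-$1$ optimal solutions of the MAXCUT SDP of $G$.
   Context: A vector $\mathbf{m}\in\mathbb{R}^n_{>0}$ ($n\ge3$) is non-dominating if $m_j<\sum_{k\neq j}m_k$ for every $j\in[n]=\{1,\dots,n\}$. The complete graph $K_n$ on vertex set $[n]$ is weighted by $\mathbf{m}$ if its edge weights are $w_{ij}=m_im_j$ for all $i\ne j$. The Laplacian $\mathcal{L}_G$ of a graph $G=(V,E)$ with edge weights $w_{ij}$ ($w_{ij}=0$ for non-edges) is the $V\times V$ matrix with off-diagonal entries $-w_{ij}$ and diagonal entries $\sum_{j\ne i}w_{ij}$. The MAXCUT SDP of $G$ is: maximize $\frac14\langle \mathcal{L}_G,\mathbf{X}\rangle$ over symmetric matrices $\mathbf{X}\in\mathbb{R}^{V\times V}$ with $X_{ii}=1$ for all $i\in V$ and $\mathbf{X}\succeq \mathbf{0}$, where $\langle \mathbf{A},\mathbf{B}\rangle=\operatorname{tr}(\mathbf{A}\mathbf{B})$. *)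

(* Defs.v *)
From mathcomp Require Import all_boot all_order all_algebra.
From mathcomp Require Import boolp classical_sets reals convex.

Set Implicit Arguments.
Unset Strict Implicit.
Unset Printing Implicit Defensive.

Import Order.TTheory GRing.Theory Num.Theory.

Local Open Scope ring_scope.

(* A weighted graph on vertex set 'I_n is represented by its matrix w of edge
   weights, with w i j = 0 for non-edges; diagonal entries of w are ignored. *)
Definition laplacian (R : realType) (n : nat) (w : 'M[R]_n) : 'M[R]_n :=
  \matrix_(i, j) if i == j then \sum_(k | k != i) w i k else - w i j.

Definition nondominating (R : realType) (n : nat) (m : 'cV[R]_n) : Prop :=
  forall j, m j 0 < \sum_(k | k != j) m k 0.

Definition complete_weights (R : realType) (n : nat) (m : 'cV[R]_n) : 'M[R]_n :=
  \matrix_(i, j) if i == j then 0 else m i 0 * m j 0.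

(* Each partition is the two-element set [set S; ~: S], so that S and its
   complement contribute a single element. *)
Definition balanced_partitions (R : realType) (n : nat) (m : 'cV[R]_n) :
    {set {set {set 'I_n}}} :=
  ([set [set S; ~: S] | S : {set 'I_n}
     & \sum_(j in S) m j 0 == \sum_(j | j \notin S) m j 0])%SET.

Definition psdmx (R : realType) (n : nat) (X : 'M[R]_n) : Prop :=
  X \is symmetricmx /\ forall v : 'cV[R]_n, 0 <= (v^T *m X *m v) 0 0.

Definition maxcut_objective (R : realType) (n : nat) (w X : 'M[R]_n) : R :=
  4^-1 * \tr (laplacian w *m X).

Definition maxcut_feasible (R : realType) (n : nat) (X : 'M[R]_n) : Prop :=
  (forall i, X i i = 1) /\ psdmx X.

Definition maxcut_optimal (R : realType) (n : nat) (w X : 'M[R]_n) : Prop :=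
  maxcut_feasible X /\
  forall Y : 'M[R]_n, maxcut_feasible Y ->
    maxcut_objective w Y <= maxcut_objective w X.

Local Open Scope classical_set_scope.

Definition convex_hull (R : realType) (M : lmodType R) (A : set M) : set M :=
  smallest (@convex_set R M) A.

Definition rank1_optimal (R : realType) (n : nat) (w : 'M[R]_n) :
    set 'M[R]_n :=
  [set X | maxcut_optimal w X /\ \rank X = 1%N].

(* Main.v *)
Require Import Defs.
From mathcomp Require Import all_boot all_order all_algebra.
From mathcomp Require Import boolp classical_sets reals convex.
From mathcomp Require Import ring lra.

(** On matrices X with unit diagonal the objective is a constant minus
    (m^T X m) / 4 ([objective_quad_form]), so once some feasible X has
    m^T X m = 0, the optimal solutions are exactly the feasible matrices with
    this property.  Such an X is the Gram matrix of unit vectors u_i with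
    sum_i m_i u_i = 0, that is, of a closed polygon with side lengths m_i.

    The optimal solution that lies outside the hull comes from a polygon with
    as many independent directions as possible: the u_i span a space of
    dimension n - 1, equivalently the kernel of X is the line through m
    ([exists_spanning_polygon]).  It is built by induction on n.  If l, a and b
    are the sides of a nondegenerate triangle, a side l of a polygon can be
    replaced with two sides a and b by drawing this triangle in the plane
    spanned by the direction of the old side and a new orthogonal direction;
    this raises the dimension of the span by exactly one
    ([spanning_polygon_unmerge]).  Conversely the first two lengths of a
    non-dominating vector of at least four lengths can always be merged into
    such an l without losing non-domination ([exists_merge]).  With three
    lengths, l is taken equal to the third one, and the induction rests on the
    flat polygon with two equal sides.

    A rank-1 optimal solution is y y^T, where y is the sign vector of a set S
    for which {S, S^c} is a balanced partition ([rank1_feasible_sign]).  As there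
    are at most n - 2 such partitions, some v != 0 is orthogonal to m and to all
    these y.  The condition v^T Y v = 0 is linear in Y and holds at every rank-1
    optimal solution, hence on their convex hull.  It fails at X, since
    v^T X v = 0 would make v a multiple of m, while v is orthogonal to m and
    nonzero. *)

Set Implicit Arguments.
Unset Strict Implicit.
Unset Printing Implicit Defensive.

Import Order.TTheory GRing.Theory Num.Theory.

Local Open Scope ring_scope.

(** * Quadratic forms *)

Definition quad_form (R : realType) (n : nat) (X : 'M[R]_n)
    (v : 'cV[R]_n) : R :=
  (v^T *m X *m v) 0 0.

Lemma quad_form_delta (R : realType) (n : nat) (X : 'M[R]_n) (i : 'I_n) :
  quad_form X (delta_mx i 0) = X i i.
Proof. by rewrite /quad_form trmx_delta -rowE -colE !mxE. Qed.

Lemma quad_formD (R : realType) (n : nat) (X Y : 'M[R]_n) (v : 'cV[R]_n) :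
  quad_form (X + Y) v = quad_form X v + quad_form Y v.
Proof. by rewrite /quad_form mulmxDr mulmxDl mxE. Qed.

Lemma quad_formZ (R : realType) (n : nat) (c : R) (X : 'M[R]_n) (v : 'cV[R]_n) :
  quad_form (c *: X) v = c * quad_form X v.
Proof. by rewrite /quad_form -scalemxAr -scalemxAl mxE. Qed.

Lemma quad_form_scale (R : realType) (n : nat) (c : R) (X : 'M[R]_n)
    (v : 'cV[R]_n) :
  quad_form X (c *: v) = c ^+ 2 * quad_form X v.
Proof.
by rewrite /quad_form -scalemxAr [(c *: v)^T]linearZ /= -!scalemxAl scalerA mxE.
Qed.

Lemma quad_form_congr (R : realType) (n p : nat) (X : 'M[R]_p)
    (T : 'M[R]_(p, n)) (v : 'cV[R]_n) :
  quad_form (T^T *m X *m T) v = quad_form X (T *m v).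
Proof. by rewrite /quad_form trmx_mul !mulmxA. Qed.

Lemma quad_form_outer (R : realType) (n : nat) (z v : 'cV[R]_n) :
  quad_form (z *m z^T) v = (\sum_i z i 0 * v i 0) ^+ 2.
Proof.
rewrite /quad_form mulmxA -mulmxA mxE big_ord1 expr2.
congr (_ * _); rewrite !mxE; apply: eq_bigr => i _; rewrite !mxE //.
exact: mulrC.
Qed.

Lemma symmetricE (R : realType) (n : nat) (X : 'M[R]_n) :
  (X \is symmetricmx) = (X == X^T).
Proof. by rewrite is_hermitianmxE expr0 scale1r map_mx_id. Qed.

(** * Optimality as vanishing of the quadratic form at m *)

(** The Laplacian is a diagonal matrix minus m m^T, and the trace of a fixed
    diagonal matrix times X does not vary when X has unit diagonal. *)
Lemma objective_quad_form (R : realType) (n : nat) (m : 'cV[R]_n) :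
  exists C : R, forall X : 'M[R]_n, (forall i, X i i = 1) ->
    maxcut_objective (complete_weights m) X = C - 4^-1 * quad_form X m.
Proof.
pose d := \row_i (m i 0 * \sum_k m k 0).
have lapE : laplacian (complete_weights m) = diag_mx d - m *m m^T.
  apply/matrixP => i j; rewrite !mxE big_ord1 !mxE.
  case: eqVneq => [<-|nij]; last by rewrite mulr0n sub0r.
  rewrite mulr1n [\sum_k m k 0](bigD1 i) //= mulrDr addrC addKr mulr_sumr.
  by apply: eq_bigr => k; rewrite !mxE eq_sym => /negbTE ->.
exists (4^-1 * \sum_i d 0 i) => X X1.
rewrite /maxcut_objective lapE mulmxBl linearB /= mulrBr; congr (_ * _ - _ * _).
  by apply: eq_bigr => i _; rewrite mul_diag_mx mxE X1 mulr1.
by rewrite -mulmxA mxtrace_mulC /mxtrace big_ord1.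
Qed.

Lemma optimal_of_null (R : realType) (n : nat) (m : 'cV[R]_n) (X : 'M[R]_n) :
  maxcut_feasible X -> quad_form X m = 0 ->
  maxcut_optimal (complete_weights m) X.
Proof.
move=> fX X0; split=> // Y [Y1 [_ Yge0]].
have [C objE] := objective_quad_form m.
rewrite !objE //; last exact: fX.1.
rewrite X0 mulr0 subr0 lerBlDr lerDl mulr_ge0 ?invr_ge0 ?ler0n //; exact: Yge0.
Qed.

Lemma null_of_optimal (R : realType) (n : nat) (m : 'cV[R]_n) (X Y : 'M[R]_n) :
  maxcut_feasible X -> quad_form X m = 0 ->
  maxcut_optimal (complete_weights m) Y -> quad_form Y m = 0.
Proof.
move=> fX X0 [[Y1 [_ Yge0]] /(_ X fX)].
have [C objE] := objective_quad_form m.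
rewrite !objE //; last exact: fX.1.
rewrite X0 mulr0 subr0 -subr_ge0 addrAC subrr sub0r oppr_ge0.
rewrite pmulr_rle0 ?invr_gt0 ?ltr0n // => Yle0.
by apply/eqP; rewrite eq_le Yle0; exact: Yge0.
Qed.

(** * Polygons spanning a space of codimension one *)

(** X is the Gram matrix of unit vectors u_i.  The second clause says that they
    are the side directions of a closed polygon with side lengths m_i, the
    third that this is their only linear relation up to scaling, so that they
    span a space of dimension n - 1. *)
Definition spanning_polygon (R : realType) (n : nat) (m : 'cV[R]_n)
    (X : 'M[R]_n) : Prop :=
  [/\ maxcut_feasible X, quad_form X m = 0 &
      forall v, quad_form X v = 0 -> exists c, v = c *: m].

Lemma spanning_polygon2 (R : realType) (m : 'cV[R]_2) :
  m 0 0 = m 1 0 -> m 0 0 != 0 -> exists X, spanning_polygon m X.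
Proof.
move=> m01 m0.
pose z : 'cV[R]_2 := \col_i (-1) ^+ i.
have qE v : quad_form (z *m z^T) v = (v 0 0 - v 1 0) ^+ 2.
  rewrite quad_form_outer big_ord_recl big_ord1 !mxE /= expr0 mul1r expr1 mulN1r.
  by congr ((_ - v _ _) ^+ 2); apply: val_inj.
exists (z *m z^T); split.
- split; last first.
    split; first by rewrite symmetricE trmx_mul trmxK.
    by move=> v; have := qE v; rewrite /quad_form => ->; exact: sqr_ge0.
  move=> i; rewrite !mxE big_ord1 !mxE -expr2 -exprM mulnC exprM.
  by rewrite sqrrN !expr1n.
- by rewrite qE m01 subrr expr0n.
move=> v; rewrite qE => /eqP; rewrite sqrf_eq0 subr_eq0 => /eqP v01.
exists (v 0 0 / m 0 0); apply/matrixP => i j; rewrite !mxE ord1.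
case: i => [[|[|//]] lti].
  by rewrite (_ : Ordinal lti = 0) ?divfK //; exact: val_inj.
by rewrite (_ : Ordinal lti = 1) -?m01 ?divfK //; exact: val_inj.
Qed.

Definition merge (R : realType) (n : nat) (l : R) (m : 'cV[R]_n.+2) :
    'cV[R]_n.+1 :=
  \col_i if i == 0 then l else m (lift 0 i) 0.

(** A triangle with sides l, a and b, its side l lying along an axis: the sides
    a and b project onto lengths p and l - p of that axis, and h is the
    height. *)
Lemma exists_triangle (R : realType) (a b l : R) :
  0 < a -> 0 < b -> `|a - b| < l -> l < a + b ->
  exists p h : R, p ^+ 2 + h ^+ 2 = a ^+ 2 /\
    (l - p) ^+ 2 + h ^+ 2 = b ^+ 2 /\ h != 0.
Proof.
move=> a0 b0 abl lab.
have l0 : 0 < l by apply: le_lt_trans abl.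
have [ab1 ab2] : - l < a - b /\ a - b < l by apply/andP; rewrite -ltr_norml.
(* Subtracting the two required equations gives 2 l p. *)
pose p := (l ^+ 2 + a ^+ 2 - b ^+ 2) / (2 * l).
have pE : 2 * l * p = l ^+ 2 + a ^+ 2 - b ^+ 2.
  by rewrite /p mulrC divfK // mulf_neq0 ?pnatr_eq0 // gt_eqF.
(* Heron's formula: 4 l^2 (a^2 - p^2) is the product of a + b + l with the
   three triangle-inequality gaps. *)
have d0 : 0 < a ^+ 2 - p ^+ 2.
  rewrite subr_sqr; apply: mulr_gt0.
    rewrite -(pmulr_rgt0 _ (mulr_gt0 (ltr0Sn R 1) l0)) mulrBr pE.
    have -> : 2 * l * a - (l ^+ 2 + a ^+ 2 - b ^+ 2)
            = (b - a + l) * (b - l + a) by ring.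
    by apply: mulr_gt0; lra.
  rewrite -(pmulr_rgt0 _ (mulr_gt0 (ltr0Sn R 1) l0)) mulrDr pE.
  have -> : 2 * l * a + (l ^+ 2 + a ^+ 2 - b ^+ 2)
          = (a + l - b) * (a + l + b) by ring.
  by apply: mulr_gt0; lra.
exists p, (Num.sqrt (a ^+ 2 - p ^+ 2)); rewrite sqr_sqrtr ?(ltW d0) //.
split; first by ring.
split; last by rewrite gt_eqF // sqrtr_gt0.
have -> : (l - p) ^+ 2 + (a ^+ 2 - p ^+ 2) = l ^+ 2 + a ^+ 2 - 2 * l * p by ring.
by rewrite pE; ring.
Qed.

(** If w is the direction of the side l in the old polygon and e is a new
    orthogonal unit vector, the first two sides become the vectors p w + h e and
    (l - p) w - h e, of lengths a and b.  In a linear relation v among the new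
    directions, the e-component forces v_0 / a = v_1 / b, as h != 0; what remains
    is a relation among the old directions, where the induction hypothesis
    applies. *)
Lemma spanning_polygon_unmerge (R : realType) (n : nat) (m : 'cV[R]_n.+2)
    (l : R) (X : 'M[R]_n.+1) :
  0 < m 0 0 -> 0 < m 1 0 -> `|m 0 0 - m 1 0| < l -> l < m 0 0 + m 1 0 ->
  spanning_polygon (merge l m) X -> exists Y, spanning_polygon m Y.
Proof.
move=> a0 b0 abl lab [[X1 [symX Xge0]] Xm Xker].
have l0 : 0 < l by apply: le_lt_trans abl.
have [p [h [pa [pb h0]]]] := exists_triangle a0 b0 abl lab.
set a := m 0 0 in a0 abl lab pa pb *; set b := m 1 0 in b0 abl lab pa pb *.
have an0 : a != 0 by rewrite gt_eqF.
have bn0 : b != 0 by rewrite gt_eqF.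
(* T v collects the coefficients that a relation v among the new directions
   induces on the old ones, and z v is its e-component. *)
pose T : 'M[R]_(n.+1, n.+2) := \matrix_(i, j)
  if i == 0 then (p / a) *+ (j == 0) + ((l - p) / b) *+ (j == 1)
  else (j == lift 0 i)%:R.
pose z : 'cV[R]_n.+2 := \col_j ((h / a) *+ (j == 0) - (h / b) *+ (j == 1)).
have sum_delta (c : R) (k : 'I_n.+2) (v : 'cV[R]_n.+2) :
    \sum_j c *+ (j == k) * v j 0 = c * v k 0.
  rewrite (bigD1 k) //= eqxx big1 ?addr0 // => j /negbTE ->.
  by rewrite mulr0n mul0r.
have TE v : T *m v =
    merge (p / a * v 0 0 + (l - p) / b * v 1 0) v.
  apply/matrixP => i j; rewrite !mxE ord1; case: ifP => i0.
    under eq_bigr do rewrite mxE i0 mulrDl.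
    by rewrite big_split /= !sum_delta.
  by under eq_bigr do rewrite mxE i0; rewrite sum_delta mul1r.
have zE (v : 'cV_n.+2) : \sum_j z j 0 * v j 0 = h * (v 0 0 / a - v 1 0 / b).
  under eq_bigr do rewrite mxE mulrBl.
  rewrite sumrB !sum_delta; ring.
pose Y := T^T *m X *m T + z *m z^T.
have qE v : quad_form Y v
    = quad_form X (T *m v) + (h * (v 0 0 / a - v 1 0 / b)) ^+ 2.
  by rewrite quad_formD quad_form_congr quad_form_outer zE.
have Yge0 v : 0 <= quad_form Y v.
  by rewrite qE addr_ge0 ?sqr_ge0 //; exact: Xge0.
have diagX c (v : 'cV_n.+1) : v = c *: delta_mx 0 0 -> quad_form X v = c ^+ 2.
  by move=> ->; rewrite quad_form_scale quad_form_delta X1 mulr1.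
exists Y; split.
- split; last first.
    split=> //; move: symX; rewrite !symmetricE => /eqP symX.
    by rewrite linearD /= !trmx_mul !trmxK -symX mulmxA.
  move=> i; rewrite -quad_form_delta qE TE !mxE.
  case: (unliftP 0 i) => [i' ->|->]; last first.
    rewrite (@diagX (p / a)) /=.
      have -> : (p / a) ^+ 2 + (h * (1 / a - 0 / b)) ^+ 2
              = (p ^+ 2 + h ^+ 2) / a ^+ 2 by field; rewrite an0 bn0.
      by rewrite pa divff // expf_neq0.
    apply/matrixP => k j; rewrite !mxE ord1 /= andbT.
    by case: eqP => _; rewrite mulr0 ?addr0.
  case: (eqVneq i' 0) => [->|i'0].
    rewrite (@diagX ((l - p) / b)) /=.
      have -> : ((l - p) / b) ^+ 2 + (h * (0 / a - 1 / b)) ^+ 2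
              = ((l - p) ^+ 2 + h ^+ 2) / b ^+ 2 by field; rewrite an0 bn0.
      by rewrite pb divff // expf_neq0.
    apply/matrixP => k j; rewrite !mxE ord1 /= !andbT.
    by rewrite (inj_eq lift_inj) mulr0 add0r; case: eqP => _; rewrite ?mulr0.
  have i'1 : (1 == lift 0 i' :> 'I_n.+2) = false.
    rewrite (_ : 1 = lift 0 0); last exact: val_inj.
    by rewrite (inj_eq lift_inj) eq_sym (negbTE i'0).
  rewrite i'1 /= !mulr0 !mul0r subrr mulr0 expr0n !addr0.
  rewrite (_ : merge _ _ = delta_mx i' 0) ?quad_form_delta //.
  apply/matrixP => k j; rewrite !mxE ord1 (inj_eq lift_inj) eqxx.
  by case: eqP => [->|//]; rewrite eq_sym (negbTE i'0).
- rewrite qE TE -/a -/b !divff // subrr mulr0 expr0n addr0.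
  by rewrite !divfK // addrC subrK.
move=> v /eqP; rewrite qE paddr_eq0 ?sqr_ge0 //; last exact: Xge0.
case/andP => /eqP /Xker [c]; rewrite TE => vE.
rewrite sqrf_eq0 mulf_eq0 (negbTE h0) /= subr_eq0 => /eqP vab.
exists c.
have mE i := congr1 (fun u : 'cV_n.+1 => u i 0) vE.
pose t := v 0 0 / a.
have v0E : v 0 0 = t * a by rewrite divfK.
have v1E : v 1 0 = t * b by rewrite /t vab divfK.
have tc : t = c.
  apply: (mulIf (negbT (gt_eqF l0))).
  have := mE 0; rewrite !mxE /= v0E v1E => <-.
  by field; rewrite an0 bn0.
rewrite tc in v0E v1E.
apply/matrixP => i j; rewrite ord1 !mxE; case: (unliftP 0 i) => [i' ->|->] //.
have := mE i'; rewrite !mxE; case: eqP => // ->.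
rewrite (_ : lift 0 0 = 1) //; exact: val_inj.
Qed.

Lemma nondominatingE (R : realType) (n : nat) (m : 'cV[R]_n) :
  nondominating m <-> forall j, 2 * m j 0 < \sum_k m k 0.
Proof.
split=> mN j; have := mN j;
  by rewrite [\sum_k _](bigD1 j) //= mulr_natl mulr2n ltrD2l.
Qed.

Lemma sum_merge (R : realType) (n : nat) (l : R) (m : 'cV[R]_n.+2) :
  \sum_k merge l m k 0 = l + \sum_k m (lift 0 (lift 0 k)) 0.
Proof.
by rewrite big_ord_recl mxE; congr (_ + _); apply: eq_bigr => k _; rewrite mxE.
Qed.

Lemma ltr_sum_pos (R : realType) (n : nat) (f : 'I_n.+2 -> R) (k : 'I_n.+2) :
  (forall j, 0 < f j) -> f k < \sum_j f j.
Proof.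
move=> f0; rewrite (bigD1 k) //= ltrDl.
have [k' kk'] : exists k', k' != k.
  by have [->|k0] := eqVneq k 0; [exists 1 | exists 0; rewrite eq_sym].
by rewrite (bigD1 k') //= ltr_wpDr // sumr_ge0 // => j _; exact: ltW.
Qed.

(** With a and b the first two entries, M the largest of the others and S their
    sum, the requirements on l are |a - b| < l < a + b and 2 M - S < l < S.  Both
    lower bounds lie below both upper bounds: M < S holds because at least two
    positive entries remain, and the other comparisons are non-domination or
    positivity. *)
Lemma exists_merge (R : realType) (n : nat) (m : 'cV[R]_n.+4) :
  (forall j, 0 < m j 0) -> nondominating m ->
  exists l, [/\ `|m 0 0 - m 1 0| < l, l < m 0 0 + m 1 0 &
                nondominating (merge l m)].
Proof.
move=> m0 /nondominatingE mN.
pose o k := m (lift 0 (lift 0 k)) 0; pose S := \sum_k o k.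
have mS : \sum_k m k 0 = m 0 0 + m 1 0 + S.
  rewrite 2!big_ord_recl addrA; congr (_ + m _ 0 + _); exact: val_inj.
have oS k : o k < S by apply: (@ltr_sum_pos _ _ o k) => j; exact: m0.
pose L := \big[Num.max/`|m 0 0 - m 1 0|]_k (2 * o k - S).
pose U := Num.min (m 0 0 + m 1 0) S.
have LU : L < U.
  have m00 := m0 0; have m10 := m0 1.
  have := mN 0; have := mN 1; rewrite mS => b2 a2.
  apply: bigmax_lt => [|k _]; rewrite lt_min.
    by rewrite !ltr_norml; do 2!(apply/andP; split); lra.
  have := mN (lift 0 (lift 0 k)); rewrite mS -/(o k) => k2.
  have := oS k => kS; apply/andP; split; lra.
have [Ll lU] := midf_lt LU.
exists ((L + U) / 2); set l := (L + U) / 2 in Ll lU *.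
move: lU; rewrite lt_min => /andP[lab lS].
split=> //; first by apply: le_lt_trans Ll; exact: bigmax_ge_id.
apply/nondominatingE => j; rewrite sum_merge -/S mxE.
case: (unliftP 0 j) => [k ->|->] /=; last by lra.
have kL : 2 * o k - S <= L by exact: le_bigmax.
rewrite -/(o k); lra.
Qed.

Lemma exists_spanning_polygon (R : realType) (n : nat) (m : 'cV[R]_n.+3) :
  (forall j, 0 < m j 0) -> nondominating m -> exists X, spanning_polygon m X.
Proof.
elim: n m => [|n IHn] m m0 mN.
  pose l := m (lift 0 (lift 0 0)) 0.
  have m01 : m (lift 0 0) 0 = m 1 0 by congr (m _ 0); exact: val_inj.
  have mS j : 2 * m j 0 < m 0 0 + (m 1 0 + l).
    move/nondominatingE: mN => /(_ j).
    by rewrite !big_ord_recl big_ord0 addr0 m01.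
  have [X] : exists X, spanning_polygon (merge l m) X.
    apply: spanning_polygon2; rewrite !mxE /=; last by rewrite gt_eqF ?m0.
    by congr (m _ 0); exact: val_inj.
  apply: spanning_polygon_unmerge => //.
    by have := mS 0; have := mS 1; rewrite ltr_norml => *; apply/andP; split; lra.
  by have := mS (lift 0 (lift 0 0)); rewrite -/l; lra.
have [l [abl lab lN]] := exists_merge m0 mN.
have [|X] := IHn (merge l m) _ lN; last exact: spanning_polygon_unmerge.
by move=> j; rewrite mxE; case: ifP => // _; apply: le_lt_trans abl.
Qed.

(** * Rank-1 solutions as balanced partitions *)

Definition sign_vector (R : realType) (n : nat) (S : {set 'I_n}) : 'cV[R]_n :=
  \col_i if i \in S then 1 else -1.

Lemma sum_sign_vector (R : realType) (n : nat) (S : {set 'I_n}) (v : 'cV[R]_n) :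
  \sum_i sign_vector R S i 0 * v i 0
    = \sum_(i in S) v i 0 - \sum_(i | i \notin S) v i 0.
Proof.
rewrite (bigID (mem S)) /= -sumrN; congr (_ + _); apply: eq_bigr => i iS.
  by rewrite mxE iS mul1r.
by rewrite mxE (negbTE iS) mulN1r.
Qed.

Lemma sum_sign_vectorC (R : realType) (n : nat) (S : {set 'I_n}) (v : 'cV[R]_n) :
  \sum_i sign_vector R (~: S)%SET i 0 * v i 0
    = - \sum_i sign_vector R S i 0 * v i 0.
Proof.
rewrite -sumrN; apply: eq_bigr => i _; rewrite !mxE finset.in_setC -mulNr.
by case: (i \in S); rewrite ?opprK.
Qed.

(** Rank 1 and symmetry give X_ij = X_i0 X_j0, so unit diagonal entries make the
    first column a vector of signs. *)
Lemma rank1_feasible_sign (R : realType) (n : nat) (X : 'M[R]_n.+1) :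
  maxcut_feasible X -> \rank X = 1%N ->
  exists S, X = sign_vector R S *m (sign_vector R S)^T.
Proof.
move=> [X1 [symX _]] rX.
have [c [r XE]] : exists (c : 'cV_n.+1) (r : 'rV_n.+1), X = c *m r.
  have := mulmx_base X; move: (col_base X) (row_base X); rewrite rX.
  by move=> c r <-; exists c, r.
have crE i j : X i j = c i 0 * r 0 j by rewrite XE mxE big_ord1.
have XM i j : X i j = X i 0 * X j 0.
  have -> : X j 0 = X 0 j.
    by move: symX; rewrite symmetricE => /eqP {1}->; rewrite mxE.
  have := X1 0; rewrite !crE => cr0.
  by rewrite -[LHS]mulr1 -cr0; ring.
exists [set i | X i 0 == 1]%SET.
suff yE i : sign_vector R [set i | X i 0 == 1]%SET i 0 = X i 0.
  by apply/matrixP => i j; rewrite mxE big_ord1 [_^T _ _]mxE !yE -XM.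
rewrite mxE inE; case: eqVneq => [//|/negbTE Xi].
by have /eqP := X1 i; rewrite XM -expr2 sqrf_eq1 Xi => /eqP.
Qed.

(** * Separation from the convex hull *)

Lemma exists_orthogonal (R : realType) (k n : nat) (B : 'M[R]_(k, n)) :
  (k < n)%N -> exists2 v : 'cV[R]_n, v != 0 & B *m v = 0.
Proof.
move=> kn.
have : kermx B^T != 0.
  rewrite -mxrank_eq0 mxrank_ker subn_eq0 -ltnNge.
  exact: leq_ltn_trans (rank_leq_col _) kn.
case/rowV0Pn => u /sub_kermxP uB u0; exists u^T; first by rewrite trmx_eq0.
by apply: trmx_inj; rewrite trmx_mul trmxK uB trmx0.
Qed.

(** For fixed v the quadratic form is linear in the matrix. *)
Lemma convex_null_quad_form (R : realType) (n : nat) (v : 'cV[R]_n) :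
  @convex_set R 'M[R]_n [set X | quad_form X v = 0]%classic.
Proof.
move=> X Y k; rewrite !inE /= => X0 Y0.
by rewrite quad_formD !quad_formZ X0 Y0 !mulr0 addr0.
Qed.


Theorem corollary8 (R : realType) (n : nat) (m : 'cV[R]_n) :
  (3 <= n)%N ->
  (forall j, 0 < m j 0) ->
  nondominating m ->
  (#|balanced_partitions m| <= n - 2)%N ->
  exists X : 'M[R]_n,
    maxcut_optimal (complete_weights m) X /\
    ~ convex_hull (rank1_optimal (complete_weights m)) X.
Proof.
case: n m => [|[|[|n]]] // m _ m0 mN bm.
have [X [fX Xm Xker]] := exists_spanning_polygon m0 mN.
exists X; split; first exact: optimal_of_null.
(* Either member of a balanced partition serves as its representative: the
   sign vectors of S and S^c are opposite, so they have the same orthogonal. *)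
pose rep (P : {set {set 'I_n.+3}}) := odflt finset.set0 [pick S in P].
pose B : 'M[R]_(1 + #|balanced_partitions m|, n.+3) := col_mx m^T
  (\matrix_i (sign_vector R (rep (enum_val i)))^T).
have [|v v0 Bv] := @exists_orthogonal _ _ _ B.
  by rewrite add1n !ltnS in bm *.
move: Bv; rewrite /B mul_col_mx -[RHS](@col_mx0 _ 1) => /eq_col_mx[mv Sv].
have repv P : P \in balanced_partitions m ->
    \sum_i sign_vector R (rep P) i 0 * v i 0 = 0.
  move=> bP; have := congr1 (fun u : 'cV_ _ => u (enum_rank_in bP P) 0) Sv.
  rewrite !mxE => Pv; rewrite -[RHS]Pv; apply: eq_bigr => i _.
  by rewrite [in RHS]mxE [_^T _ _]mxE enum_rankK_in.
have subv : (rank1_optimal (complete_weights m) `<=`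
    [set Y | quad_form Y v = 0])%classic.
  move=> Y [oY rY] /=; have Ym := null_of_optimal fX Xm oY.
  have [S YE] := rank1_feasible_sign oY.1 rY.
  have bS : [set S; ~: S]%SET \in balanced_partitions m.
    apply/imsetP; exists S => //; rewrite inE -subr_eq0 -sum_sign_vector.
    by move/eqP: Ym; rewrite YE quad_form_outer sqrf_eq0.
  rewrite YE quad_form_outer; have := repv _ bS; rewrite /rep.
  case: pickP => [T|/(_ S)]; last by rewrite !inE eqxx.
  rewrite !inE /= => /orP[] /eqP ->; first by move->; rewrite expr0n.
  rewrite sum_sign_vectorC => /eqP; rewrite oppr_eq0 => /eqP ->.
  by rewrite expr0n.
move=> /(_ _ (conj (@convex_null_quad_form _ _ v) subv)) /= /Xker[c vE].
move/matrixP: mv => /(_ 0 0); rewrite vE -scalemxAr !mxE => /eqP.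
rewrite mulf_eq0 => /orP[/eqP c0|]; first by rewrite vE c0 scale0r eqxx in v0.
rewrite psumr_eq0 => [/allP /(_ 0)|i _]; rewrite mxE.
  by rewrite mem_index_enum mulf_eq0 orbb gt_eqF // => /(_ isT).
by rewrite -expr2 sqr_ge0.
Qed.
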